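(* Let $1\le r\le5$ be an integer and $0<\delta\le1$, and let $a,b,c$ be the polynomials of the order-$r$ scheme with parameter $\delta$, with associated sets $\mathcal{D}_y$ ($y<0$), $\mathcal{D}_{-\infty}$ and $\mathcal{D}$, and quantity $G(\delta)$, all as defined in the context. (i) If $r=1$, then $\mathcal{D}=\mathcal{D}_{-\infty}$. (ii) If $2\le r\le5$ and $G(\delta)>0$, then $$\mu\in\mathcal{D}_{-\infty}\ \Longrightarrow\ \mu\in\mathcal{D}_y\ \text{ for every } y<0;$$ that is, $\mathcal{D}_{-\infty}\subseteq\mathcal{D}_y$ for every $y<0$. As a result, $\mathcal{D}=\mathcal{D}_{-\infty}$.
   Context: Polynomials. $c(z)=(z-1+\delta)^r$, $b(z)=(z-1+\delta)^r-(z-1)^r$, and $a(z)=\sum_{j=1}^r\frac{f^{(j)}(1)}{j!}(z-1)^j$ with $f(z)=(\ln z)(z-1+\delta)^r$, i.e. $a$ is the $r$-th order Taylor polynomial of $f$ at $z=1$. Stability sets. For $y<0$, $\mathcal{D}_y$ is the set of $\mu\in\mathbb{C}$ such that every solution $\zeta\in\mathbb{C}$ of $a(\zeta)=y\,c(\zeta)-y\mu\,b(\zeta)$ satisfies $|\zeta|<1$. $\mathcal{D}_{-\infty}$ is the set of $\mu\in\mathbb{C}$ such that every root $\zeta$ of $c(\zeta)-\mu b(\zeta)$ satisfies $|\zeta|<1$. $\mathcal{D}=\mathcal{D}_{-\infty}\cap\bigcap_{y<0}\mathcal{D}_y$. Boundary locus. For $y<0$, $\Gamma_y=\big\{\frac{1}{b(z)}\big(c(z)-y^{-1}a(z)\big):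 z\in\mathbb{C},\ |z|=1\big\}$. The function $\varphi$. $\varphi(\mu)=\big(\frac{\mu}{\mu-1}\big)^{1/r}$, where the $r$-th root is $(Re^{i\theta})^{1/r}=R^{1/r}e^{i\theta/r}$ for $R\ge0$, $-\pi<\theta\le\pi$. The point $\mu=1$ is mapped to $\infty$. The quantity $G$ (depending on $r$ and $\delta$): $$G(\delta)=\inf_{y<0}\ \min_{w\in\Gamma_y}\Big[\big(\mathrm{Re}(\varphi(w))-(1-\delta/2)\big)(1-y)\,\delta^{-2}\Big],$$ where the point $w=1$ (at which $\varphi$ is infinite) is disregarded and the inner minimum is understood as an infimum. *)

(* Defs.v *)
From HB Require Import structures.
From mathcomp Require Import all_boot all_order all_algebra.
From mathcomp Require Import complex.
From mathcomp Require Import all_classical all_reals all_analysis.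
Import Order.TTheory GRing.Theory Num.Theory.
Import numFieldNormedType.Exports.

Set Implicit Arguments.
Unset Strict Implicit.
Unset Printing Implicit Defensive.

Local Open Scope classical_set_scope.
Local Open Scope complex_scope.
Local Open Scope ring_scope.

Section Polynomials.
Context {R : realType}.
Variables (r : nat) (delta : R).

Definition cpol : {poly R[i]} := ('X - 1 + (delta%:C)%:P) ^+ r.

Definition bpol : {poly R[i]} := ('X - 1 + (delta%:C)%:P) ^+ r - ('X - 1) ^+ r.

(* The restriction of (ln z) (z - 1 + delta)^r to the real line.  As this
   function is holomorphic near 1, its derivatives at 1 are those of its
   restriction.  The values of [ln] on nonpositive reals play no role. *)
Definition flog (x : R) : R := ln x * (x - 1 + delta) ^+ r.

Definition apol : {poly R[i]} :=
  \sum_(1 <= j < r.+1) (derive1n j flog 1 / j`!%:R)%:C *: ('X - 1) ^+ j.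

End Polynomials.

Section StabilitySets.
Context {R : realType}.
Variables (r : nat) (delta : R).
Local Notation a := (apol r delta).
Local Notation b := (bpol r delta).
Local Notation c := (cpol r delta).

Definition Dy (y : R) : set R[i] :=
  [set mu | forall zeta : R[i],
     a.[zeta] = y%:C * c.[zeta] - y%:C * mu * b.[zeta] -> `|zeta| < 1].

Definition Dminfty : set R[i] :=
  [set mu | forall zeta : R[i], root (c - mu *: b) zeta -> `|zeta| < 1].

Definition Dset : set R[i] :=
  Dminfty `&` \bigcap_(y in [set y : R | y < 0]) Dy y.

(* For 1 <= r <= 5 and 0 < delta <= 1 the polynomial b has no root on the unit
   circle, as such a root requires delta = 4 sin^2 (pi k / r) for some
   0 < k < r; no division by zero occurs below. *)
Definition Gamma (y : R) : set R[i] :=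
  [set (b.[z])^-1 * (c.[z] - y^-1%:C * a.[z]) | z in [set z : R[i] | `|z| = 1]].

End StabilitySets.

Section PrincipalRoot.
Context {R : realType}.

Definition cpolar (rho theta : R) : R[i] :=
  (rho * cos theta) +i* (rho * sin theta).

(* For z = 0 the angle is not unique, which is harmless in [croot] below. *)
Definition carg (z : R[i]) : R :=
  xget 0 [set theta | - pi < theta <= pi /\ z = cpolar (Normc.normc z) theta].

Lemma carg_def (z : R[i]) :
  - pi < carg z <= pi /\ z = cpolar (Normc.normc z) (carg z).
Proof.
rewrite /carg; case: xgetP => [//|none]; exfalso.
case: z none => x y none.
have pi0 := pi_gt0 R.
set n := Num.sqrt (x ^+ 2 + y ^+ 2).
have [n0|n0] := eqVneq n 0.
  apply: (none 0); split; first by rewrite oppr_lt0 pi0 ltW.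
  have /Normc.eq0_normc -> : Normc.normc (x +i* y) = 0 by [].
  by rewrite Normc.normc0 /cpolar !mul0r.
have np : 0 < n by rewrite lt_neqAle eq_sym n0 sqrtr_ge0.
have n2 : n ^+ 2 = x ^+ 2 + y ^+ 2 by rewrite sqr_sqrtr// addr_ge0// sqr_ge0.
have xn : -1 <= x / n <= 1.
  rewrite -ler_norml normrM normfV (gtr0_norm np) ler_pdivrMr// mul1r.
  by rewrite -sqrtr_sqr ler_wsqrtr// lerDl sqr_ge0.
have sn : n * sin (acos (x / n)) = `|y|.
  rewrite sin_acos// -{1}(gtr0_norm np) -sqrtr_sqr -sqrtrM ?sqr_ge0//.
  by rewrite mulrBr mulr1 expr_div_n mulrCA divff ?expf_neq0// mulr1 n2 addrC
    addKr sqrtr_sqr.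
have cn : n * cos (acos (x / n)) = x by rewrite acosK// mulrCA divff// mulr1.
have [y0|y0] := leP 0 y.
  apply: (none (acos (x / n))); split.
    by rewrite acos_lepi// andbT (lt_le_trans _ (acos_ge0 xn))// oppr_lt0.
  by rewrite /cpolar /= -/n cn sn ger0_norm.
have xn1 : -1 < x / n.
  rewrite lt_neqAle (andP xn).1 andbT; apply/eqP => e.
  move: sn; rewrite -e acosN1 sinpi mulr0 => /eqP.
  by rewrite eq_sym normr_eq0 lt_eqF.
apply: (none (- acos (x / n))); split.
  rewrite ltrN2 acos_ltpi ?xn1 ?(andP xn).2//= (le_trans _ (ltW pi0))//.
  by rewrite oppr_le0 acos_ge0.
by rewrite /cpolar /= -/n cosN sinN mulrN cn sn ltr0_norm// opprK.
Qed.

Definition croot (r : nat) (z : R[i]) : R[i] :=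
  cpolar (Normc.normc z `^ (r%:R)^-1) (carg z / r%:R).

(* Meaningful for mu != 1 only; the value at mu = 1 is never used. *)
Definition phi (r : nat) (mu : R[i]) : R[i] := croot r (mu / (mu - 1)).

End PrincipalRoot.

Definition G {R : realType} (r : nat) (delta : R) : \bar R :=
  ereal_inf [set
    ereal_inf [set
      ((complex.Re (phi r w) - (1 - delta / 2)) * (1 - y) * delta ^- 2)%:E
      | w in Gamma r delta y `\ 1]
    | y in [set y : R | y < 0]].

(* Main.v *)
Require Import Defs.
From HB Require Import structures.
From mathcomp Require Import all_boot all_order all_algebra.
From mathcomp Require Import complex.
From mathcomp Require Import all_classical all_reals all_analysis.
From mathcomp Require Import ring lra.
Import Order.TTheory GRing.Theory Num.Theory.
Import numFieldNormedType.Exports.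

Set Implicit Arguments.
Unset Strict Implicit.
Unset Printing Implicit Defensive.

Local Open Scope classical_set_scope.
Local Open Scope complex_scope.
Local Open Scope ring_scope.

(** Put [t = - 1 / y].  A parameter [mu] lies in [Dy y] as soon as all roots of
    the polynomial [P_t = (c - mu b) + t a] lie in the open unit disc, and
    [Dminfty] is the same condition at [t = 0].  So the point is to follow the
    roots of [P_t] as [t] grows from [0].

    Two things could go wrong.  A root could come in from infinity: this is
    excluded because the coefficient of [X^r] in [P_t] is [1 + t a_r], where
    [a_r = \sum_(1 <= m <= r) (1 - (1 - delta)^m) / m >= 0] is the top Taylor
    coefficient of [ln z (z - 1 + delta)^r] ([log_pow_tower], [apol_coef_r],
    [size_scheme]).  Or a root could cross the unit circle at some [z]: as [b]
    has no zero there when [r <= 5] ([bpol_circle_neq0]), [mu] would then be a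
    point of [Gamma y].

    The second case contradicts [0 < G].  Solving [c = mu b] through the
    substitution [w = 1 + delta / (zeta - 1)] turns it into
    [w ^ r = mu / (mu - 1)], and [|zeta| < 1] into [Re w < 1 - delta / 2]
    ([mobius_lt1]); as [phi mu] is one of these [w], every [mu] in [Dminfty]
    satisfies [Re (phi mu) < 1 - delta / 2] ([Dminfty_root]), while [0 < G]
    forces the opposite inequality on [Gamma y] ([Gamma_Dminfty]).

    Hence the set of [t] for which [P_t] has all its roots in the disc contains
    [0] and is both open and closed ([stable_homotopy]), so it is everything.
    For [r = 1] the single root of [P_t] is a convex combination of [1] and the
    root of [P_0] with a positive weight on the latter, which settles that case
    directly ([Dminfty_sub_Dy1]). *)

(** * Roots in the unit disc along a segment of polynomials *)
Section Homotopy.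
Context {R : realType}.
Implicit Types (p q : {poly R[i]}) (z : R[i]).

Lemma prodr_const_seq (S : pzSemiRingType) (I : Type) (s : seq I) (x : S) :
  \prod_(i <- s) x = x ^+ size s.
Proof. by rewrite big_const_seq count_predT iter_mulr_1. Qed.

Definition stable p := forall z, root p z -> `|z| < 1.

Lemma stable_factors p n : size p = n.+1 -> stable p ->
  exists rs : seq R[i], [/\ size rs = n, all (fun w => `|w| < 1) rs &
    forall z, p.[z] = p`_n * \prod_(w <- rs) (z - w)].
Proof.
move=> sp stp; have [rs def_p] := closed_field_poly_normal p.
have lp : lead_coef p = p`_n by rewrite lead_coefE sp.
have p0 : lead_coef p != 0 by rewrite lead_coef_eq0 -size_poly_gt0 sp.
have hp z : p.[z] = p`_n * \prod_(w <- rs) (z - w).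
  rewrite {1}def_p hornerZ lp horner_prod; congr (_ * _).
  by apply: eq_bigr => w _; rewrite hornerXsubC.
exists rs; split=> //.
  by move: sp; rewrite {1}def_p size_scale// size_prod_XsubC => -[].
apply/allP => w wrs; apply: stp; rewrite /root hp.
by rewrite (big_rem w)//= subrr mul0r mulr0.
Qed.

(** Outside the disc each factor satisfies [|z - w| >= |z| (1 - |w|)].  The power
    [|z|^n] makes the bound uniform against a perturbation of degree at most
    [n], although [z] ranges over an unbounded set. *)
Lemma stable_lower_bound p n : size p = n.+1 -> stable p ->
  exists2 m : R[i], 0 < m &
    forall z, 1 <= `|z| -> m * `|z| ^+ n <= `|p.[z]|.
Proof.
move=> sp stp; have [rs [srs rs1 hp]] := stable_factors sp stp.
have pn0 : p`_n != 0.
  have -> : p`_n = lead_coef p by rewrite lead_coefE sp.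
  by rewrite lead_coef_eq0 -size_poly_gt0 sp.
exists (`|p`_n| * \prod_(w <- rs) (1 - `|w|)).
  rewrite mulr_gt0 ?normr_gt0// big_seq prodr_gt0// => w wrs.
  by rewrite subr_gt0 (allP rs1).
move=> z z1; rewrite hp normrM normr_prod -mulrA ler_wpM2l//.
rewrite -srs -prodr_const_seq -big_split/=.
rewrite big_seq [leRHS]big_seq ler_prod// => w wrs.
have w1 := allP rs1 _ wrs.
rewrite mulr_ge0 ?subr_ge0 ?(ltW w1)//=.
apply: le_trans (lerB_dist _ _); rewrite mulrBl mul1r lerB//.
by rewrite ler_peMr.
Qed.

(** A bound that is uniform in the stable polynomial, unlike the preceding one:
    it survives the passage to a limit of stable polynomials, and thus shows
    that stability can only be lost through the unit circle. *)
Lemma stable_norm_ge p n z : size p = n.+1 -> stable p -> 1 <= `|z| ->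
  `|p`_n| * (`|z| - 1) ^+ n <= `|p.[z]|.
Proof.
move=> sp stp z1; have [rs [srs rs1 ->]] := stable_factors sp stp.
rewrite normrM normr_prod ler_wpM2l// -srs -(prodr_const_seq rs).
rewrite big_seq [leRHS]big_seq ler_prod// => w wrs.
rewrite subr_ge0 z1/=; apply: le_trans (lerB_dist _ _).
by rewrite lerB// ltW// (allP rs1).
Qed.

Lemma horner_norm_le q n : (size q <= n.+1)%N ->
  exists2 K : R[i], 0 <= K &
    forall z, 1 <= `|z| -> `|q.[z]| <= K * `|z| ^+ n.
Proof.
move=> sq; exists (\sum_(i < n.+1) `|q`_i|); first by rewrite sumr_ge0.
move=> z z1; rewrite (horner_coef_wide z sq) (le_trans (ler_norm_sum _ _ _))//.
rewrite mulr_suml ler_sum// => i _; rewrite normrM normrX ler_wpM2l//.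
by rewrite ler_weXn2l// -ltnS.
Qed.

Lemma norm_real_complex (d : R) : `|d%:C| = `|d|%:C :> R[i].
Proof. by rewrite normc_def /= expr0n addr0 sqrtr_sqr. Qed.

(** Moduli live in [R[i]], while the parameter of a homotopy is real. *)
Lemma small_scale (m K : R[i]) : 0 < m -> 0 <= K ->
  exists2 e : R, 0 < e & forall d : R, `|d| < e -> `|d|%:C * K < m.
Proof.
move=> m0 K0; rewrite -(RRe_real (gtr0_real m0)) -(RRe_real (ger0_real K0)).
move: m0 K0; rewrite !lecE !ltcE /= => /andP[_ m0] /andP[_ K0].
have K1 : 0 < complex.Re K + 1 by rewrite ltr_wpDl.
exists (complex.Re m / (complex.Re K + 1)); first by rewrite divr_gt0.
move=> d; rewrite ltr_pdivlMr// => dm.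
rewrite -rmorphM/= ltcR (le_lt_trans _ dm)// ler_wpM2l//.
by rewrite lerDl.
Qed.

(** The parameters for which the polynomial is stable form an open set by
    [stable_lower_bound], and a closed one by [stable_norm_ge] and the absence
    of roots on the circle; connectedness concludes.  The constant size keeps
    roots from escaping to, or coming in from, infinity. *)
Lemma stable_homotopy p q n :
  (forall t : R, 0 <= t -> size (p + t%:C *: q) = n.+1) ->
  (forall (t : R) z, 0 <= t -> root (p + t%:C *: q) z -> `|z| != 1) ->
  stable p -> forall t : R, 0 <= t -> stable (p + t%:C *: q).
Proof.
move=> sizeP circP stp.
(* Folding the parameter by the absolute value extends the family from the
   half-line to the whole connected line. *)
pose P (t : R) := p + `|t|%:C *: q.
have sP t : size (P t) = n.+1 by apply: sizeP.
have cP t z : root (P t) z -> `|z| != 1 by apply: circP.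
have sq : (size q <= n.+1)%N.
  have -> : q = (p + 1%:C *: q) - (p + 0%:C *: q).
    by rewrite scale0r scale1r addr0 addrC addKr.
  by rewrite (leq_trans (size_polyD _ _))// size_polyN !sizeP ?maxnn.
have Pdiff s t z : (P s).[z] - (P t).[z] = (`|s| - `|t|)%:C * q.[z].
  by rewrite !hornerE rmorphB/= mulrBl opprD addrACA subrr add0r.
have dst (s t : R) : `|(`|s| - `|t|)%:C| <= `|t - s|%:C :> R[i].
  by rewrite norm_real_complex lecR distrC ler_dist_dist.
(* A root z of P_s with |z| >= 1 would give m |z|^n <= |t - s| K |z|^n. *)
have openS t : stable (P t) -> exists2 e : R, 0 < e &
    forall s : R, `|t - s| < e -> stable (P s).
  move=> stt; have [m m0 mP] := stable_lower_bound (sP t) stt.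
  have [K K0 KP] := horner_norm_le sq.
  have [e e0 eP] := small_scale m0 K0; exists e => // s ts z rz.
  have [//|z1] := real_ltP (normr_real z) (@real1 R[i]).
  have zn : 0 < `|z| ^+ n by rewrite exprn_gt0// (lt_le_trans ltr01).
  suff : m * `|z| ^+ n < m * `|z| ^+ n by rewrite ltxx.
  apply: (le_lt_trans (mP z z1)).
  have -> : (P t).[z] = (`|t| - `|s|)%:C * q.[z].
    by rewrite -Pdiff (rootP rz) subr0.
  rewrite normrM; apply: (@le_lt_trans _ _ (`|t - s|%:C * (K * `|z| ^+ n))).
    by rewrite ler_pM// ?KP// distrC.
  by rewrite mulrA ltr_pM2r// eP.
(* If z is a root of P_t outside the disc, then P_s is small at z for s close
   to t, while stability of P_s would keep it large. *)
have openN t : ~ stable (P t) -> exists2 e : R, 0 < e &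
    forall s : R, `|t - s| < e -> ~ stable (P s).
  move=> /existsNP[z /not_implyP[rz /negP]].
  have [//|z1 _] := real_ltP (normr_real z) (@real1 R[i]).
  have {}z1 : 1 < `|z| by rewrite lt_neqAle eq_sym (cP t).
  have zn : 0 < (`|z| - 1) ^+ n by rewrite exprn_gt0// subr_gt0.
  have Pn0 : (P t)`_n != 0.
    have -> : (P t)`_n = lead_coef (P t) by rewrite lead_coefE sP.
    by rewrite lead_coef_eq0 -size_poly_gt0 sP.
  have m0 : 0 < `|(P t)`_n| * (`|z| - 1) ^+ n by rewrite mulr_gt0// normr_gt0.
  have K0 : 0 <= `|q.[z]| + `|q`_n| * (`|z| - 1) ^+ n.
    by rewrite addr_ge0// mulr_ge0// ltW.
  have [e e0 eP] := small_scale m0 K0; exists e => // s ts sts.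
  suff : `|(P t)`_n| * (`|z| - 1) ^+ n < `|(P t)`_n| * (`|z| - 1) ^+ n.
    by rewrite ltxx.
  apply: le_lt_trans (eP _ ts).
  have -> : (P t)`_n = (P s)`_n + (`|t| - `|s|)%:C * q`_n.
    by rewrite !(coefD, coefZ) rmorphB/=; ring.
  apply: (@le_trans _ _ ((`|(P s)`_n| + `|t - s|%:C * `|q`_n|)
      * (`|z| - 1) ^+ n)).
    rewrite ler_pM2r// (le_trans (ler_normD _ _))// lerD2l normrM ler_wpM2r//.
    by rewrite distrC.
  rewrite mulrDl mulrDr mulrA lerD2r.
  apply: le_trans (stable_norm_ge (sP s) sts (ltW z1)) _.
  have -> : (P s).[z] = (`|s| - `|t|)%:C * q.[z].
    by rewrite -Pdiff (rootP rz) subr0.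
  by rewrite normrM ler_wpM2r.
have connR : connected [set: R] by apply/connected_intervalP.
have openB (B : set R) : (forall t, B t -> exists2 e : R, 0 < e &
    forall s : R, `|t - s| < e -> B s) -> open B.
  move=> hB; rewrite openE => t /hB[e e0 eB]; apply/nbhs_ballP.
  by exists e => //= s; rewrite -ball_normE; apply: eB.
have : [set t | stable (P t)] = [set: R].
  apply: connR.
  - by exists 0; rewrite /= /P normr0 scale0r addr0.
  - by exists [set t | stable (P t)]; [apply: openB|rewrite setTI].
  - by exists [set t | stable (P t)]; [rewrite -openC; apply: openB|rewrite setTI].
move=> ST t t0; have : [set: R] t by [].
by rewrite -ST /= /P ger0_norm.
Qed.

End Homotopy.

(** * Derivatives of all orders of the logarithm times a power *)
Section DerivativeTowers.
Context {R : realType}.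
Implicit Types (F : nat -> R -> R) (x e : R).

(** The successive derivatives are prescribed on the open half-line only, since
    that is where [ln] and the inverse are differentiable. *)
Definition deriv_tower F := forall k x, 0 < x -> is_derive x 1 (F k) (F k.+1 x).

Lemma derive1n_tower F n x : deriv_tower F -> 0 < x -> derive1n n (F 0) x = F n x.
Proof.
move=> towF; elim: n x => [//|n IHn] x x0; rewrite derive1nS derive1E.
rewrite (@near_eq_derive _ _ _ _ (F n)).
  by have ? := towF n x x0; rewrite derive_val.
by near=> z; apply: IHn; near: z; exact: lt_nbhsr.
Unshelve. all: by end_near. Qed.

Definition inv_tower k x : R := (-1) ^+ k * k`!%:R * x ^- k.+1.

Lemma is_derive_exprV n x : 0 < x ->
  is_derive x 1 (fun z : R => z ^- n) (- n%:R * x ^- n.+1).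
Proof.
move=> x0; have xn0 : x ^+ n != 0 by rewrite expf_neq0 ?gt_eqF.
have dX : derivable (@GRing.exp R ^~ n) x 1 by apply: exprn_derivable.
apply: DeriveDef; first exact: derivableV.
rewrite deriveV// exp_derive scaler1 /GRing.scale/=.
case: n {xn0 dX} => [|n]; first by rewrite !(mul0r, oppr0, mulr0).
by rewrite /= !exprS; field; rewrite expf_neq0 ?gt_eqF// gt_eqF.
Qed.

Lemma deriv_tower_inv : deriv_tower inv_tower.
Proof.
move=> k x x0; have d := is_derive_exprV k.+1 x0.
have -> : inv_tower k.+1 x
    = ((-1) ^+ k * k`!%:R) *: (- k.+1%:R * x ^- k.+2) :> R.
  by rewrite /inv_tower /GRing.scale/= factS natrM exprS; ring.
exact: is_deriveZ.
Qed.

Definition ln_tower k : R -> R := if k is k'.+1 then inv_tower k' else @ln R.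

Lemma deriv_tower_ln : deriv_tower ln_tower.
Proof.
case=> [|k] x x0 /=; last exact: deriv_tower_inv.
rewrite /inv_tower expr0 fact0 !mul1r expr1; exact: is_derive1_ln.
Qed.

Lemma deriv_tower_poly (p : {poly R}) : deriv_tower (fun k => horner p^`(k)).
Proof. by move=> k x _; rewrite derivnS; apply: is_derive_poly. Qed.

Lemma deriv_tower_lin (a : R) F G : deriv_tower F -> deriv_tower G ->
  deriv_tower (fun k x => a * F k x + G k x).
Proof.
move=> tF tG k x x0; have ? := tF k x x0; have ? := tG k x x0.
exact: is_deriveD.
Qed.

(** Euclidean division by [X], remembering only the [n]-th derivative of the
    quotient, which is constant as the quotient is monic of degree [n]. *)
Lemma quotX_poly (q : {poly R}) n : q \is monic -> size q = n.+2 ->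
  exists p : {poly R}, p^`(n) = n`!%:R%:P /\
    forall x, q.[x] = p.[x] * x + q.[0].
Proof.
move=> /monicP mq sq; exists (drop_poly 1 q); split.
  apply/polyP => i; rewrite coefE coef_drop_poly coefC addn1.
  case: i => [|i]; first by rewrite addn0 -mq lead_coefE sq ffactnn.
  by rewrite nth_default ?mul0rn// sq addnS -addSn ltnS leq_addr.
move=> x; rewrite -{1}(poly_take_drop 1 q) hornerD hornerM hornerXn expr1 addrC.
congr (_ + _); rewrite horner_coef0; rewrite (@size1_polyC _ (take_poly 1 q)).
  by rewrite hornerC coef_take_poly.
exact: size_take_poly.
Qed.

(** The [n]-th derivative of [f_n = ln x (x - e)^n] has a closed form, by
    induction on [n]: [f_(n+1)' = (n+1) f_n + (x - e)^(n+1) / x], and the last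
    term is a monic polynomial of degree [n] plus [(- e)^(n+1) / x], whose [n]-th
    derivative is [n! (1 - (e / x)^(n+1))].  Each step thus contributes one
    visibly nonnegative term at [x = 1] when [0 <= e <= 1], a sign that the
    alternating sum given by the Leibniz formula would hide. *)
Lemma log_pow_tower e n : exists F, [/\ deriv_tower F,
  forall x, F 0%N x = ln x * (x - e) ^+ n &
  forall x, 0 < x -> F n x =
    n`!%:R * (ln x + \sum_(m < n) (1 - (e / x) ^+ m.+1) / m.+1%:R)].
Proof.
elim: n => [|n [F [tF F0 Fn]]].
  exists ln_tower; split; first exact: deriv_tower_ln.
    by move=> x; rewrite expr0 mulr1.
  by move=> x _; rewrite big_ord0 addr0 fact0 mul1r.
have [p [pn qE]] : exists p : {poly R}, p^`(n) = n`!%:R%:P /\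
    forall x, (('X - e%:P) ^+ n.+1).[x] = p.[x] * x + (('X - e%:P) ^+ n.+1).[0].
  by apply: quotX_poly; [rewrite monic_exp// monicXsubC|rewrite size_exp_XsubC].
pose a := (- e) ^+ n.+1.
have {}qE x : (x - e) ^+ n.+1 = p.[x] * x + a.
  by move: (qE x); rewrite !horner_exp !hornerXsubC sub0r.
pose g k x := n.+1%:R * F k x + (a * inv_tower k x + p^`(k).[x]).
have tg : deriv_tower g.
  apply: deriv_tower_lin => //; apply: deriv_tower_lin.
    exact: deriv_tower_inv.
  exact: deriv_tower_poly.
exists (fun k => if k is k'.+1 then g k' else fun x => ln x * (x - e) ^+ n.+1).
split=> //.
  case=> [|k] x x0; last exact: tg.
  have dl := is_derive1_ln x0.
  have dp : is_derive x 1 (fun z : R => (z - e) ^+ n.+1) (n.+1%:R * (x - e) ^+ n).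
    have := is_derive_poly (('X - e%:P) ^+ n.+1) x.
    rewrite deriv_exp derivXsubC mul1r hornerMn horner_exp hornerXsubC.
    rewrite -mulr_natl; congr is_derive; apply/funext => z.
    by rewrite horner_exp hornerXsubC.
  apply: (is_derive_eq (is_deriveM dl dp)).
  rewrite /g F0 /inv_tower /GRing.scale/= expr0 fact0 expr1 qE.
  by field; rewrite gt_eqF.
move=> x x0; rewrite /g Fn// pn hornerC big_ord_recr /= /inv_tower /a.
have sgn : (- e) ^+ n.+1 * (-1) ^+ n = - e ^+ n.+1.
  by rewrite -(mulN1r e) exprMn mulrAC -exprD addSn addnn exprS -signr_odd odd_double
    mulr1 mulN1r.
rewrite -[(-1) ^+ n * _ * _]mulrA [_ * ((-1) ^+ n * _)]mulrA sgn.
rewrite factS natrM expr_div_n.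
have : n.+1%:R != 0 :> R by rewrite pnatr_eq0.
have : x ^+ n.+1 != 0 by rewrite expf_neq0// gt_eqF.
move: (x ^+ n.+1) (e ^+ n.+1) (n.+1%:R) (\sum_(m < n) _) => X E N S X0 N0.
by field; rewrite N0 X0.
Qed.

End DerivativeTowers.

(** * The Taylor polynomial a *)
Section TaylorPolynomial.
Context {R : realType}.
Variables (r : nat) (delta : R).

Lemma flog_derivn : derive1n r (flog r delta) 1 =
  r`!%:R * \sum_(m < r) (1 - (1 - delta) ^+ m.+1) / m.+1%:R.
Proof.
have [F [tF F0 Fr]] := log_pow_tower (1 - delta) r.
have -> : flog r delta = F 0%N.
  by apply/funext => x; rewrite F0 /flog opprB addrA addrAC.
by rewrite (derive1n_tower _ tF) ?ltr01// Fr ?ltr01// ln1 add0r divr1.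
Qed.

Lemma size_apol : (size (apol r delta) <= r.+1)%N.
Proof.
apply: (leq_trans (size_sum _ _ _)); rewrite big_seq_cond.
apply: (big_ind (fun m => (m <= r.+1)%N)) => [//|m n mr nr|j].
  by rewrite geq_max mr.
rewrite andbT mem_index_iota => /andP[_ jr].
by rewrite (leq_trans (size_scale_leq _ _))// -polyC1 size_exp_XsubC.
Qed.

Lemma apol_coef_r : (0 < r)%N ->
  (apol r delta)`_r =
  (\sum_(m < r) (1 - (1 - delta) ^+ m.+1) / m.+1%:R)%:C.
Proof.
move=> r0; rewrite /apol coef_sum big_nat_recr//= big_nat_cond big1 => [|j].
  have := monic_exp r (monicXsubC (1 : R[i])).
  rewrite monicE lead_coefE size_exp_XsubC /= polyC1 => /eqP lc.
  rewrite add0r coefZ lc mulr1 flog_derivn mulrAC divff ?mul1r//.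
rewrite andbT => /andP[_ jr].
by rewrite coefZ nth_default ?mulr0// -polyC1 size_exp_XsubC.
Qed.

End TaylorPolynomial.

(** * The substitution w = 1 + delta / (zeta - 1) *)

Section Scheme.
Context {R : realType}.
Implicit Types (r : nat) (delta y : R) (mu w zeta : R[i]).

Lemma horner_cpol r delta zeta :
  (cpol r delta).[zeta] = (zeta - 1 + delta%:C) ^+ r.
Proof. by rewrite /cpol horner_exp !hornerE. Qed.

Lemma horner_bpol r delta zeta :
  (bpol r delta).[zeta] = (zeta - 1 + delta%:C) ^+ r - (zeta - 1) ^+ r.
Proof. by rewrite /bpol !(hornerD, hornerN, horner_exp) !hornerE. Qed.

(** At [mu = 1] the polynomial [c - mu b] is [(X - 1)^r], which vanishes at [1]. *)
Lemma Dminfty_neq1 r delta mu : (0 < r)%N -> Dminfty r delta mu -> mu != 1.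
Proof.
move=> r0 Dmu; apply/eqP => mu1; move: Dmu; rewrite mu1 => /(_ 1).
suff r1 : root (cpol r delta - 1 *: bpol r delta) 1.
  by move=> /(_ r1); rewrite normr1 ltxx.
rewrite /root hornerD hornerN hornerZ horner_cpol horner_bpol.
by rewrite mul1r subKr subrr expr0n gtn_eqF.
Qed.

(** The map [w |-> zeta = 1 + delta / (w - 1)] is an involution which exchanges
    the unit disc and the half-plane [Re w < 1 - delta / 2], as this formula for
    [|zeta|^2] makes plain. *)
Lemma mobius_norm delta w : w != 1 ->
  `|1 + delta%:C / (w - 1)| ^+ 2 =
  1 + (2 * delta * (complex.Re w - (1 - delta / 2)))%:C / `|w - 1| ^+ 2.
Proof.
move=> w1; have w10 : w - 1 != 0 by rewrite subr_eq0.
have n0 : `|w - 1| ^+ 2 != 0 by rewrite expf_neq0// normr_eq0.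
have -> : 1 + delta%:C / (w - 1) = (w - 1 + delta%:C) / (w - 1).
  by rewrite mulrDl divff.
rewrite normf_div expr_div_n -[X in _ = X + _](divff n0) -mulrDl; congr (_ / _).
rewrite -!add_Re2_Im2 -rmorphD; congr (_%:C).
by case: w {w1 w10 n0} => u v /=; lra.
Qed.

Lemma mobius_lt1 delta w : 0 < delta -> w != 1 ->
  (`|1 + delta%:C / (w - 1)| < 1) = (complex.Re w < 1 - delta / 2).
Proof.
move=> d0 w1; have n0 : 0 < `|w - 1| ^+ 2 by rewrite exprn_gt0// normr_gt0 subr_eq0.
rewrite -(@ltr_pXn2r _ 2)// ?nnegrE// expr1n mobius_norm// gtrDl.
rewrite pmulr_llt0 ?invr_gt0// ltcR pmulr_rlt0 ?mulr_gt0//.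
by rewrite subr_lt0.
Qed.

Lemma mobius_eq1 delta w : 0 < delta -> w != 1 ->
  `|1 + delta%:C / (w - 1)| = 1 -> complex.Re w = 1 - delta / 2.
Proof.
move=> d0 w1 n1; have := mobius_norm delta w1.
have n0 : `|w - 1| ^+ 2 != 0 by rewrite expf_neq0// normr_eq0 subr_eq0.
rewrite n1 expr1n -{1}[1]addr0 => /addrI/esym/eqP.
rewrite mulf_eq0 invr_eq0 (negbTE n0) orbF => /eqP[] /eqP.
by rewrite !mulf_eq0 pnatr_eq0 (gt_eqF d0)/= subr_eq0 => /eqP.
Qed.

(** For [zeta = 1 + delta / (w - 1)] one has [zeta - 1 + delta = w (zeta - 1)], so
    [c - mu b = (1 - mu) (zeta - 1 + delta)^r + mu (zeta - 1)^r] vanishes at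
    [zeta] exactly when [(1 - mu) w^r + mu = 0]. *)
Lemma Dminfty_root r delta mu w : 0 < delta ->
  Dminfty r delta mu -> mu != 1 -> w ^+ r = mu / (mu - 1) ->
  complex.Re w < 1 - delta / 2.
Proof.
move=> d0 Dmu mu1 wr.
have mu10 : mu - 1 != 0 by rewrite subr_eq0.
have w1 : w != 1.
  apply/eqP => w1; move: (mulfVK mu10 mu); rewrite -wr w1 expr1n mul1r.
  by move=> /eqP; rewrite -subr_eq0 addrAC subrr sub0r oppr_eq0 oner_eq0.
rewrite -mobius_lt1//; apply: Dmu.
have w10 : w - 1 != 0 by rewrite subr_eq0.
rewrite /root hornerD hornerN hornerZ horner_cpol horner_bpol.
have -> : 1 + delta%:C / (w - 1) - 1 + delta%:C = delta%:C / (w - 1) * w.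
  by field.
have -> : 1 + delta%:C / (w - 1) - 1 = delta%:C / (w - 1) by ring.
rewrite [(_ * w) ^+ _]exprMn wr; apply/eqP.
move: ((_ / _) ^+ r) => s.
by field.
Qed.

(** This is [cos (2 pi / 5) < 1 / 2]; the bound fails for sixth roots of unity.
    On the unit circle [w^2 + 1 = 2 (Re w) w], which turns
    [1 + w + ... + w^(r - 1) = 0] into a real equation for [Re w]. *)
Lemma root_of_unity_Re r w : (r <= 5)%N -> (0 < r)%N ->
  w ^+ r = 1 -> w != 1 -> complex.Re w < 1 / 2.
Proof.
move=> r5 r0 wr w1.
have nw : `|w| = 1.
  apply/eqP; rewrite -(@pexpr_eq1 _ _ r)// -normrX wr normr1 //.
have w0 : w != 0 by rewrite -normr_eq0 nw oner_eq0.
pose T := 2 * complex.Re w.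
have wT : w ^+ 2 + 1 = T%:C * w.
  have := add_Re2_Im2 w; rewrite nw expr1n; case: w @T {r0 wr w1 nw w0} => u v T /=.
  move=> /eqP; rewrite eq_complex /= => /andP[/eqP uv _].
  apply/eqP; rewrite eq_complex /T /=; apply/andP; split; apply/eqP; nra.
have : \sum_(i < r) w ^+ i = 0.
  move/eqP: (subrX1 w r); rewrite wr subrr eq_sym mulf_eq0 subr_eq0.
  by rewrite (negbTE w1) => /eqP.
have wN : w + 1 = 0 -> complex.Re w < 1 / 2.
  move=> /eqP; rewrite addr_eq0 => /eqP ->; rewrite /=; lra.
have fin (k : nat) (x : R) : w ^+ k * x%:C = 0 -> x = 0.
  by move=> /eqP; rewrite mulf_eq0 expf_eq0 (negbTE w0) andbF/= => /eqP[].
case: r r5 r0 {wr} => [//|[|[|[|[|[|//]]]]]] _ _.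
- by rewrite big_ord1 expr0 => /eqP; rewrite oner_eq0.
- by rewrite !big_ord_recr big_ord0 /= add0r expr0 expr1 addrC.
- rewrite !big_ord_recr big_ord0 /= add0r expr0 expr1.
  have -> : 1 + w + w ^+ 2 = w ^+ 2 + 1 + w by ring.
  rewrite wT => e; have : T + 1 = 0.
    by apply: (fin 1%N); rewrite -e rmorphD/= rmorph1; ring.
  by rewrite /T; lra.
- rewrite !big_ord_recr big_ord0 /= add0r expr0 expr1.
  have -> : 1 + w + w ^+ 2 + w ^+ 3 = (w ^+ 2 + 1) * (w + 1) by ring.
  rewrite wT => /eqP; rewrite mulf_eq0 => /orP[|/eqP/wN//] /eqP e.
  have : T = 0 by apply: (fin 1%N); rewrite -e; ring.
  by rewrite /T; lra.
- rewrite !big_ord_recr big_ord0 /= add0r expr0 expr1.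
  have -> : 1 + w + w ^+ 2 + w ^+ 3 + w ^+ 4
      = (w ^+ 2 + 1) ^+ 2 + w * (w ^+ 2 + 1) - w ^+ 2 by ring.
  rewrite wT => e; have : T ^+ 2 + T - 1 = 0.
    by apply: (fin 2%N); rewrite -e !rmorphD rmorphN rmorphXn rmorph1 /=; ring.
  by rewrite /T; nra.
Qed.

(** A zero of [b] on the circle gives an [r]-th root of unity [w <> 1] with
    [Re w = 1 - delta / 2 >= 1 / 2]. *)
Lemma bpol_circle_neq0 r delta zeta : (1 <= r <= 5)%N -> 0 < delta <= 1 ->
  `|zeta| = 1 -> (bpol r delta).[zeta] != 0.
Proof.
move=> /andP[r0 r5] /andP[d0 d1] n1; rewrite horner_bpol.
have dC0 : delta%:C != 0 :> R[i].
  by rewrite eq_complex /= eqxx andbT gt_eqF.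
have [->|z1] := eqVneq zeta 1.
  by rewrite subrr add0r expr0n gtn_eqF// subr0 expf_neq0.
have z10 : zeta - 1 != 0 by rewrite subr_eq0.
apply/negP => /eqP/subr0_eq e.
pose w := (zeta - 1 + delta%:C) / (zeta - 1).
have wr : w ^+ r = 1 by rewrite /w expr_div_n e divff// expf_neq0.
have w1E : w - 1 = delta%:C / (zeta - 1) by rewrite /w; field.
have w1 : w != 1 by rewrite -subr_eq0 w1E mulf_neq0// invr_eq0.
have := root_of_unity_Re r5 r0 wr w1.
rewrite (@mobius_eq1 delta)//; first by lra.
rewrite w1E; have -> : 1 + delta%:C / (delta%:C / (zeta - 1)) = zeta.
  by field; rewrite z10.
by [].
Qed.

(** * The boundary locus and the homotopy *)

Lemma cpolar_exp (rho theta : R) n :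
  cpolar rho theta ^+ n = cpolar (rho ^+ n) (theta *+ n).
Proof.
elim: n => [|n IHn].
  by rewrite !expr0 mulr0n /cpolar cos0 sin0 mul1r mulr0.
rewrite exprSr IHn /cpolar mulrSr cosD sinD exprSr.
by apply/eqP; rewrite eq_complex /=; apply/andP; split; apply/eqP; ring.
Qed.

Lemma croot_exp r (z : R[i]) : (0 < r)%N -> croot r z ^+ r = z.
Proof.
move=> r0; have rR : r%:R != 0 :> R by rewrite pnatr_eq0 -lt0n.
rewrite /croot cpolar_exp -(mulr_natr (carg z / _)) mulfVK// -powR_mulrn ?powR_ge0//.
rewrite -powRrM mulVf// powRr1; last by case: z => a b; apply: sqrtr_ge0.
by rewrite -(carg_def z).2.
Qed.


(** On [Gamma y] positivity of [G] gives [Re (phi mu) > 1 - delta / 2], whereas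
    [phi mu], being an [r]-th root of [mu / (mu - 1)], is subject to the opposite
    bound when [mu] is in [Dminfty]. *)
Lemma Gamma_Dminfty r delta y mu : 0 < delta -> (0 < r)%N -> (0 < G r delta)%E ->
  y < 0 -> Gamma r delta y mu -> ~ Dminfty r delta mu.
Proof.
move=> d0 r0 G0 y0 Gmu Dmu; have mu1 := Dminfty_neq1 r0 Dmu.
have := Dminfty_root d0 Dmu mu1 (croot_exp (mu / (mu - 1)) r0).
apply/negP; rewrite -leNgt ltW// -subr_gt0.
have : (0 < ((complex.Re (phi r mu) - (1 - delta / 2)) * (1 - y)
    * delta ^- 2)%:E)%E.
  apply: (lt_le_trans G0); apply: (@le_trans _ _ (ereal_inf [set
      ((complex.Re (phi r w) - (1 - delta / 2)) * (1 - y) * delta ^- 2)%:E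
      | w in Gamma r delta y `\ 1])); apply: ereal_inf_lbound.
    by exists y.
  by exists mu => //; split=> //; apply/eqP.
by rewrite lte_fin !pmulr_lgt0// ?invr_gt0 ?exprn_gt0// subr_gt0 (lt_trans y0).
Qed.

Lemma Dy_stable r delta mu y : y < 0 ->
  stable (cpol r delta - mu *: bpol r delta + (- y^-1)%:C *: apol r delta) ->
  Dy r delta y mu.
Proof.
move=> y0 st zeta e; apply: st; rewrite /root.
rewrite hornerD hornerZ hornerD hornerN hornerZ e rmorphN fmorphV.
have yC0 : y%:C != 0 :> R[i] by rewrite eq_complex /= eqxx andbT lt_eqF.
by apply/eqP; field.
Qed.

(** [c - mu b] is monic of degree [r], and the coefficient of [X^r] in [a] is
    nonnegative, so the leading coefficient is at least [1] for all [t >= 0]. *)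
Lemma size_scheme r delta mu (t : R) : (0 < r)%N -> 0 < delta <= 1 -> 0 <= t ->
  size (cpol r delta - mu *: bpol r delta + t%:C *: apol r delta) = r.+1.
Proof.
move=> r0 /andP[d0 d1] t0.
have cE : cpol r delta = ('X - (1 - delta%:C)%:P) ^+ r.
  by rewrite /cpol polyCB polyC1 opprB addrA addrAC.
have sc : size (cpol r delta) = r.+1 by rewrite cE size_exp_XsubC.
have mc : (cpol r delta)`_r = 1.
  have := monic_exp r (monicXsubC (1 - delta%:C)).
  by rewrite -cE monicE lead_coefE sc => /eqP.
have sX : size (('X - 1 : {poly R[i]}) ^+ r) = r.+1.
  by rewrite -polyC1 size_exp_XsubC.
have mX : (('X - 1 : {poly R[i]}) ^+ r)`_r = 1.
  have := monic_exp r (monicXsubC (1 : R[i])).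
  by rewrite polyC1 monicE lead_coefE sX => /eqP.
have sb : (size (bpol r delta) <= r.+1)%N.
  by rewrite (leq_trans (size_polyD _ _))// size_polyN sc sX maxnn.
have mb : (bpol r delta)`_r = 0.
  by rewrite /bpol -/(cpol r delta) coefB mc mX subrr.
apply/eqP; rewrite eqn_leq; apply/andP; split.
  rewrite (leq_trans (size_polyD _ _))// geq_max.
  rewrite (leq_trans (size_polyD _ _))/= ?geq_max ?sc ?size_polyN ?leqnn/=.
    by rewrite (leq_trans (size_scale_leq _ _))// size_apol.
  by rewrite (leq_trans (size_scale_leq _ _)).
rewrite ltnNge; apply/negP => /leq_sizeP/(_ r (leqnn r)).
rewrite coefD coefB !coefZ mc mb apol_coef_r// mulr0 subr0 -rmorphM/=.
set s := \sum_(m < r) _.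
have s0 : 0 <= s.
  apply: sumr_ge0 => m _; rewrite divr_ge0// subr_ge0 exprn_ile1//.
    by rewrite subr_ge0.
  by rewrite gerBl ltW.
move=> /eqP; rewrite eq_complex /= => /andP[/eqP e _].
by have := mulr_ge0 t0 s0; lra.
Qed.

Lemma Dminfty_sub_Dy r delta mu y : (1 <= r <= 5)%N -> 0 < delta <= 1 ->
  (0 < G r delta)%E -> y < 0 -> Dminfty r delta mu -> Dy r delta y mu.
Proof.
move=> r15 d01 G0 y0 Dmu; have /andP[r0 _] := r15; have /andP[d0 _] := d01.
apply: Dy_stable => //.
apply: (@stable_homotopy _ _ _ r); last by rewrite oppr_ge0 invr_le0 ltW.
- by move=> t t0; apply: size_scheme.
- move=> t z; rewrite le_eqVlt => /predU1P[<-|t0].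
    by rewrite scale0r addr0 => /Dmu/lt_eqF ->.
  move=> rz; apply/eqP => z1.
  have b0 := bpol_circle_neq0 r15 d01 z1.
  apply: (@Gamma_Dminfty r delta (- t^-1) mu d0 r0 G0) Dmu.
    by rewrite oppr_lt0 invr_gt0.
  exists z => //; apply: (mulfI b0); rewrite mulVKf//.
  move: rz; rewrite /root hornerD hornerZ hornerD hornerN hornerZ.
  rewrite invrN invrK rmorphN mulNr opprK => /eqP e.
  by apply: subr0_eq; rewrite -[RHS]e; ring.
- exact: Dmu.
Qed.

Lemma apol1 delta : apol 1 delta = delta%:C *: ('X - 1).
Proof.
rewrite /apol big_nat1 expr1 flog_derivn big_ord1 (_ : 1`! = 1%N)// !expr1.
by rewrite subKr !divr1 mul1r.
Qed.

(** With [z0] the root of [c - mu b], the only solution of the equation defining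
    [Dy] is [(1 - s) + s z0] with [0 < s < 1]. *)
Lemma Dminfty_sub_Dy1 delta mu y : 0 < delta -> y < 0 ->
  Dminfty 1 delta mu -> Dy 1 delta y mu.
Proof.
move=> d0 y0 Dmu zeta; rewrite apol1 horner_cpol horner_bpol !expr1 !hornerE.
move=> e; pose z0 := 1 - delta%:C * (1 - mu).
have z01 : `|z0| < 1.
  apply: Dmu; rewrite /root hornerD hornerN hornerZ horner_cpol horner_bpol.
  by apply/eqP; rewrite /z0; ring.
have dy : 0 < delta - y by rewrite subr_gt0 (lt_trans y0).
have dyC : delta%:C - y%:C != 0 :> R[i].
  by rewrite -rmorphB eq_complex /= eqxx andbT gt_eqF.
pose s := - y / (delta - y).
have s0 : 0 < s by rewrite divr_gt0// oppr_gt0.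
have s1 : s < 1 by rewrite ltr_pdivrMr// mul1r ltrDr.
have -> : zeta = (1 - s)%:C + s%:C * z0.
  have sE : s%:C = - y%:C / (delta%:C - y%:C).
    by rewrite rmorphM fmorphV rmorphN rmorphB.
  have -> : zeta = 1 + y%:C * delta%:C * (1 - mu) / (delta%:C - y%:C).
    apply: (mulfI dyC); apply: subr0_eq.
    move/eqP: e; rewrite -subr_eq0 => /eqP <-.
    by field.
  by rewrite rmorphB rmorph1 /= sE /z0; field.
apply: (le_lt_trans (ler_normD _ _)); rewrite normrM !norm_real_complex.
rewrite (gtr0_norm s0) (@gtr0_norm _ (1 - s)) ?subr_gt0//.
have -> : 1 = (1 - s)%:C + s%:C :> R[i] by rewrite -rmorphD/= subrK.
by rewrite ltrD2l gtr_pMr// ltcR.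
Qed.

End Scheme.

Unset Implicit Arguments.

Theorem proposition4p4 (R : realType) (r : nat) (delta : R) :
  (1 <= r <= 5)%N -> 0 < delta <= 1 ->
  (r = 1%N -> Dset r delta = Dminfty r delta) /\
  ((2 <= r <= 5)%N -> (0 < G r delta)%E ->
     (forall mu : R[i], Dminfty r delta mu ->
        forall y : R, y < 0 -> Dy r delta y mu) /\
     Dset r delta = Dminfty r delta).
Proof.
move=> r15 d01.
have DsetE : (forall mu : R[i], Dminfty r delta mu ->
    forall y : R, y < 0 -> Dy r delta y mu) -> Dset r delta = Dminfty r delta.
  move=> sub; apply/seteqP; split=> mu; first by case.
  by move=> Dmu; split=> // y y0; apply: sub.
split=> [r1|_ G0].
  apply: DsetE => mu Dmu y y0; subst r.
  by apply: Dminfty_sub_Dy1 => //; case/andP: d01.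
have sub : forall mu : R[i], Dminfty r delta mu ->
    forall y : R, y < 0 -> Dy r delta y mu.
  by move=> mu Dmu y y0; apply: Dminfty_sub_Dy.
by split=> //; apply: DsetE.
Qed.
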